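(* Consider the sets $\Pi\subseteq\mathfrak S_3$ such that either $\Pi\supseteq\{123,321\}$ or $\#\Pi\ge4$. (1) All inv-Wilf equivalences among such $\Pi$ are trivial. (2) Each of the following is a maj-Wilf equivalence class: \begin{align*} &\big\{\{123,132,213,231\},\{123,132,231,312\}\big\},\\ &\big\{\{123,132,213,312\},\{123,213,231,312\}\big\},\\ &\big\{\{123,132,312,321\},\{123,213,231,321\}\big\},\\ &\big\{\{132,213,231,321\},\{132,231,312,321\}\big\},\\ &\big\{\{132,213,312,321\},\{213,231,312,321\}\big\},\\ &\big\{\{123,132,213,231,321\},\{123,132,231,312,321\}\big\},\\ &\big\{\{123,132,213,312,321\},\{123,213,231,312,321\}\big\}, \end{align*} and all other maj-Wilf equivalence classes of such $\Pi$ consist of a single set.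
   Context: $\mathfrak S_n$ is the set of permutations $\sigma=a_1a_2\ldots a_n$ of $[n]$ in one-line notation. A permutation $\sigma$ avoids $\pi\in\mathfrak S_k$ if no subsequence of $\sigma$ is order isomorphic to $\pi$ (has its entries in the same relative order as $\pi$). For a set $\Pi$ of permutations, $\mathrm{Av}_n(\Pi)$ is the set of $\sigma\in\mathfrak S_n$ avoiding every element of $\Pi$. Let $\mathrm{inv}\,\sigma=\#\{(i,j): i<j,\ a_i>a_j\}$ and $\mathrm{maj}\,\sigma=\sum_{i:\,a_i>a_{i+1}} i$. For $\mathrm{st}\in\{\mathrm{inv},\mathrm{maj}\}$, sets $\Pi,\Pi'$ are st-Wilf equivalent if $\sum_{\sigma\in \mathrm{Av}_n(\Pi)}q^{\mathrm{st}\,\sigma}=\sum_{\sigma\in \mathrm{Av}_n(\Pi')}q^{\mathrm{st}\,\sigma}$ for all $n\ge0$; equivalence classes are taken among subsets of $\mathfrak S_3$. The dihedral group of the square acts on permutations through their diagrams $\{(i,a_i)\}$; an inv-Wilf equivalence between $\Pi$ and $\Pi'$ is called trivial if $\Pi'=f(\Pi)$ (elementwise) for some $f\in\{R_0,R_{180},r_{-1},r_1\}$, where $R_0$ is the identity, $R_{180}$ is rotation by $180^\circ$ (reverse-complement), $r_1$ is reflection in the diagonal of slope $1$ (inverse), and $r_{-1}$ is reflection in the diagonal of slope $-1$ (inverse of the reverse-complement). *)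

(* Defs.v *)
From HB Require Import structures.
From mathcomp Require Import all_boot all_order all_algebra.
From mathcomp Require Import fingroup perm.

Set Implicit Arguments.
Unset Strict Implicit.
Unset Printing Implicit Defensive.

Import GRing.Theory.
Local Open Scope nat_scope.

(* Positions and values of [s : 'S_n] are numbered from 0 in ['I_n]; only
   [oneline] and [maj_stat] below use the customary numbering from 1. *)

Definition oneline n (s : 'S_n) : seq nat := [seq (s i).+1 | i <- enum 'I_n].

Lemma oneline_inj n : injective (@oneline n).
Proof.
move=> s t /eq_in_map est; apply/permP => i; apply/val_inj.
by have /succn_inj := est i (mem_enum _ i).
Qed.

Definition occurrence k n (p : 'S_k) (s : 'S_n) (f : {ffun 'I_k -> 'I_n}) : bool :=
  [forall i : 'I_k, forall j : 'I_k, (i < j) ==> (f i < f j)] &&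
  [forall i : 'I_k, forall j : 'I_k, (s (f i) < s (f j)) == (p i < p j)].

Definition avoids k n (p : 'S_k) (s : 'S_n) : bool :=
  ~~ [exists f : {ffun 'I_k -> 'I_n}, occurrence p s f].

Definition Av n k (P : {set 'S_k}) : {set 'S_n} :=
  [set s | [forall p in P, avoids p s]].

Definition statistic := forall n, 'S_n -> nat.

Definition inv_stat : statistic := fun n s =>
  #|[set ij : 'I_n * 'I_n | (ij.1 < ij.2) && (s ij.2 < s ij.1)]|.

(* A descent at the 0-based position i contributes i.+1. *)
Definition maj_stat : statistic := fun n s =>
  \sum_(ij : 'I_n * 'I_n | (ij.2 == ij.1.+1 :> nat) && (s ij.2 < s ij.1)) ij.1.+1.

Definition genpoly (st : statistic) n k (P : {set 'S_k}) : {poly int} :=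
  (\sum_(s in Av n P) 'X^(st n s))%R.

Definition Wilf_equiv (st : statistic) k (P Q : {set 'S_k}) : Prop :=
  forall n, genpoly st n P = genpoly st n Q.

Definition Wilf_class (st : statistic) k (C : {set {set 'S_k}}) : Prop :=
  exists P, forall Q, Q \in C <-> Wilf_equiv st P Q.

Definition rev_perm n : 'S_n := perm (@rev_ord_inj n).

Definition R0 n (s : 'S_n) : 'S_n := s.
Definition R180 n (s : 'S_n) : 'S_n := (rev_perm n * s * rev_perm n)%g.
Definition r1 n (s : 'S_n) : 'S_n := (s^-1)%g.
Definition rm1 n (s : 'S_n) : 'S_n := r1 (R180 s).

Lemma R180E n (s : 'S_n) i : R180 s i = rev_ord (s (rev_ord i)).
Proof. by rewrite /R180 !permM !permE. Qed.

Definition trivially_equiv k (P Q : {set 'S_k}) : Prop :=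
  [\/ Q = @R0 k @: P, Q = @R180 k @: P, Q = @rm1 k @: P | Q = @r1 k @: P].

(* The permutation with the given one-line notation; the default value 1 is
   never used below, by [oneline_patterns]. *)
Definition of_oneline n (w : seq nat) : 'S_n :=
  odflt 1%g [pick s : 'S_n | oneline s == w].

Definition p123 : 'S_3 := of_oneline 3 [:: 1; 2; 3].
Definition p132 : 'S_3 := of_oneline 3 [:: 1; 3; 2].
Definition p213 : 'S_3 := of_oneline 3 [:: 2; 1; 3].
Definition p231 : 'S_3 := of_oneline 3 [:: 2; 3; 1].
Definition p312 : 'S_3 := of_oneline 3 [:: 3; 1; 2].
Definition p321 : 'S_3 := of_oneline 3 [:: 3; 2; 1].

Lemma of_onelineK n (w : seq nat) :
  perm_eq w (iota 1 n) -> oneline (of_oneline n w) = w.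
Proof.
move=> eqw; have szw : size w = n by rewrite (perm_size eqw) size_iota.
have wP i : i < n -> 0 < nth 0 w i <= n.
  move=> lt_in; have: nth 0 w i \in w by rewrite mem_nth ?szw.
  by rewrite (perm_mem eqw) mem_iota add1n ltnS.
have ltP (i : 'I_n) : (nth 0 w i).-1 < n.
  by have /andP[w_gt0 w_le] := wP i (ltn_ord i); rewrite prednK.
have injf : injective (fun i => Ordinal (ltP i)).
  move=> i j [] eq_ij; apply/val_inj/eqP.
  have uw : uniq w by rewrite (perm_uniq eqw) iota_uniq.
  rewrite -(nth_uniq 0 _ _ uw) ?szw ?ltn_ord //.
  have /andP[wi _] := wP i (ltn_ord i); have /andP[wj _] := wP j (ltn_ord j).
  by rewrite -(prednK wi) -(prednK wj) eq_ij.
have onew : oneline (perm injf) = w.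
  apply: (@eq_from_nth _ 0); rewrite size_map size_enum_ord ?szw // => i lt_in.
  rewrite (nth_map (Ordinal lt_in)) ?size_enum_ord // permE /= nth_enum_ord //.
  by have /andP[w_gt0 _] := wP i lt_in; rewrite prednK.
rewrite /of_oneline; case: pickP => [s /eqP // | /(_ (perm injf))].
by rewrite onew eqxx.
Qed.

Lemma oneline_patterns :
  [/\ oneline p123 = [:: 1; 2; 3], oneline p132 = [:: 1; 3; 2]
    & oneline p213 = [:: 2; 1; 3]] /\
  [/\ oneline p231 = [:: 2; 3; 1], oneline p312 = [:: 3; 1; 2]
    & oneline p321 = [:: 3; 2; 1]].
Proof. by split; split; apply: of_onelineK. Qed.

Definition contains_mono_or_large (P : {set 'S_3}) : bool :=
  ([set p123; p321] \subset P) || (4 <= #|P|).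

Definition listed_classes : seq {set {set 'S_3}} :=
  [:: [set [set p123; p132; p213; p231]; [set p123; p132; p231; p312]];
      [set [set p123; p132; p213; p312]; [set p123; p213; p231; p312]];
      [set [set p123; p132; p312; p321]; [set p123; p213; p231; p321]];
      [set [set p132; p213; p231; p321]; [set p132; p231; p312; p321]];
      [set [set p132; p213; p312; p321]; [set p213; p231; p312; p321]];
      [set [set p123; p132; p213; p231; p321]; [set p123; p132; p231; p312; p321]];
      [set [set p123; p132; p213; p312; p321]; [set p123; p213; p231; p312; p321]]].

(* Main.v *)
Require Import Defs.
From mathcomp Require Import all_boot all_order all_algebra.
From mathcomp Require Import fingroup perm.
From mathcomp Require Import zify.

(** Inequivalent sets are told apart by very short permutations, so every
    non-equivalence is a finite computation.

    For [inv], length 3 is enough: a permutation of length 3 avoids P exactly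
    when it is not in P, and the numbers of inversions of 123, 132, 213, 231,
    312, 321 are 0, 1, 1, 2, 2, 3.  Equality of the two polynomials thus says
    that P and Q contain the same elements of {123, 321} and equally many
    elements of {132, 213} and of {231, 312}; so Q is P up to exchanging
    132 with 213 and exchanging 231 with 312, and these two exchanges are
    [rm1] and [r1], with [R180] as their composite
    ([trivially_equiv_of_inv3]).

    For [maj], lengths 3 and 4 separate each P of the family from all subsets
    of S_3 but itself and its partner in the list ([maj_partners]).

    It remains to see that the listed pairs are equivalent
    ([maj_equiv_listed]).  Lengths below 5 are a computation.  From length 5
    on, a set containing 123 and 321 is avoided by no permutation: of two
    consecutive comparisons in any subsequence of length 3 one is an ascent
    and the other a descent, which is impossible among five entries
    ([Av_mono_empty], a case of Erdos-Szekeres).  In the four other pairs only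
    two patterns are left to the subsequences of length 3: a monotone one and
    one that differs from it in the comparisons involving its last
    (respectively first) entry.  Then there are just two avoiders, the monotone
    permutation and the one in which the last (respectively first) entry has
    been moved to another height ([Av_last_moved], [Av_first_moved]).  The two
    sets of a pair differ only in the height reached: either the next one, or
    the opposite extreme.  The comparisons of adjacent entries do not depend on
    this choice, and hence neither does [maj] ([genpoly_last_moved],
    [genpoly_first_moved]). *)

Set Implicit Arguments.
Unset Strict Implicit.
Unset Printing Implicit Defensive.

Import GRing.Theory Num.Theory.
Local Open Scope nat_scope.

(** * Order types of triples *)

(** Three comparisons determine the order type of a triple of distinct numbers;
    with words as arguments they can be evaluated, which the comparisons of the
    values of an abstract permutation cannot. *)
Definition pat (w : seq nat) (i j k : nat) : bool * bool * bool :=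
  (nth 0 w j < nth 0 w i, nth 0 w k < nth 0 w i, nth 0 w k < nth 0 w j).

Lemma nth_oneline n (s : 'S_n) (i : 'I_n) : nth 0 (oneline s) i = (s i).+1.
Proof. by rewrite (nth_map i) ?size_enum_ord // nth_ord_enum. Qed.

Lemma size_oneline n (s : 'S_n) : size (oneline s) = n.
Proof. by rewrite size_map size_enum_ord. Qed.

Lemma pat_oneline n (s : 'S_n) (i j k : 'I_n) :
  pat (oneline s) i j k = (s j < s i, s k < s i, s k < s j).
Proof. by rewrite /pat !nth_oneline !ltnS. Qed.

Lemma perm_ltn_asym n (s : 'S_n) (i j : 'I_n) :
  i != j -> (s i < s j) = ~~ (s j < s i).
Proof.
move=> ne_ij; rewrite -leqNgt ltn_neqAle; case: eqP => //= e_s.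
by move: ne_ij; rewrite (perm_inj (val_inj e_s)) eqxx.
Qed.

Definition patterns : seq 'S_3 := [:: p123; p132; p213; p231; p312; p321].

(** The triples of comparisons realized by 123, 132, 213, 231, 312, 321, in this
    order; the two missing triples would violate transitivity of the order. *)
Definition codes : seq (bool * bool * bool) :=
  [:: (false, false, false); (false, false, true); (true, false, false);
      (false, true, true); (true, true, false); (true, true, true)].

Definition code (p : 'S_3) := pat (oneline p) 0 1 2.

Lemma map_code_patterns : [seq code p | p <- patterns] = codes.
Proof.
rewrite /patterns /code /=.
by case: oneline_patterns => [[-> -> ->] [-> -> ->]].
Qed.

Lemma uniq_patterns : uniq patterns.
Proof. by apply: (@map_uniq _ _ code); rewrite map_code_patterns. Qed.

Lemma mem_patterns p : p \in patterns.
Proof.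
have sub: {subset patterns <= enum {: 'S_3}} by move=> q _; rewrite mem_enum.
have sz: size (enum {: 'S_3}) <= size patterns by rewrite -cardE card_Sn.
by have [_ ->] := uniq_min_size uniq_patterns sub sz; rewrite mem_enum.
Qed.

(** An occurrence of a pattern of length 3 is the same as three positions whose
    comparisons are those of the pattern, because the remaining clauses of
    [occurrence] follow by antisymmetry. *)
Lemma avoidsP n (p : 'S_3) (s : 'S_n) :
  reflect (forall i j k : 'I_n, i < j -> j < k -> pat (oneline s) i j k <> code p)
          (avoids p s).
Proof.
pose o0 := @Ordinal 3 0 isT; pose o1 := @Ordinal 3 1 isT; pose o2 := @Ordinal 3 2 isT.
have pE : code p = pat (oneline p) o0 o1 o2 by [].
have o3P (Q : 'I_3 -> 'I_3 -> Prop) :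
    Q o0 o1 -> Q o0 o2 -> Q o1 o2 -> forall a b : 'I_3, a < b -> Q a b.
  move=> q01 q02 q12 [a ha] [b hb] /= lt_ab.
  move: a b ha hb lt_ab => [|[|[|?]]] // [|[|[|?]]] // ha hb _;
    by rewrite (bool_irrelevance ha isT) (bool_irrelevance hb isT).
apply: (iffP idP) => [/existsP av i j k ij jk | H].
  rewrite pE !pat_oneline => -[e01 e02 e12]; case: av.
  have ik := ltn_trans ij jk.
  pose f := [ffun x : 'I_3 => nth k [:: i; j; k] x].
  have f_mono (a b : 'I_3) : a < b -> f a < f b.
    by move: a b; apply: o3P; rewrite !ffunE.
  have f_lt (a b : 'I_3) : a < b -> (s (f b) < s (f a)) = (p b < p a).
    by move: a b; apply: o3P; rewrite !ffunE.
  exists f; apply/andP; split; apply/forallP => a; apply/forallP => b.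
    by apply/implyP; apply: f_mono.
  case: (ltngtP a b) => [lt_ab | lt_ba | /val_inj ->]; last by rewrite !ltnn.
    have ne_ab : a != b by rewrite -val_eqE neq_ltn lt_ab.
    have ne_f : f a != f b by rewrite -val_eqE neq_ltn f_mono.
    by rewrite (perm_ltn_asym _ ne_ab) (perm_ltn_asym _ ne_f) f_lt.
  by rewrite f_lt.
apply/existsP => -[f /andP[/forallP mono /forallP same]].
have lt_f (a b : 'I_3) : a < b -> f a < f b by have /forallP/(_ b)/implyP := mono a.
have lt_s (a b : 'I_3) : (s (f a) < s (f b)) = (p a < p b).
  by have /forallP/(_ b)/eqP := same a.
apply: (H (f o0) (f o1) (f o2)); rewrite ?lt_f //.
by rewrite pE !pat_oneline !lt_s.
Qed.

(** * Sets of patterns as masks *)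

Definition masks : seq bitseq :=
  iter 6 (fun ms => map (cons true) ms ++ map (cons false) ms) [:: [::]].

Lemma mem_masks m : size m = 6 -> m \in masks.
Proof.
by move: m => [|a [|b [|c [|d [|e [|f [|? ?]]]]]]] //; case: a b c d e f => [] [] [] [] [] [].
Qed.

Lemma size_masks m : m \in masks -> size m = 6.
Proof.
have /allP sz : all (fun m => size m == 6) masks by [].
by move/sz/eqP.
Qed.

(** Subsets of S_3 are encoded by bit masks over [patterns] so that statements
    about all of them, or all pairs of them, become computations. *)
Definition pset (m : bitseq) : {set 'S_3} := [set p in mask m patterns].

Lemma pset_surj (P : {set 'S_3}) : exists2 m, m \in masks & P = pset m.
Proof.
exists [seq p \in P | p <- patterns]; first exact: mem_masks.
by apply/setP => p; rewrite inE -filter_mask mem_filter mem_patterns andbT.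
Qed.

Lemma card_pset m : size m = 6 -> #|pset m| = count id m.
Proof.
by move=> sz; rewrite cardsE (card_uniqP _) ?size_mask ?mask_uniq ?uniq_patterns.
Qed.

Lemma mem_mask6 (T : eqType) (a b c d e f : bool) (x1 x2 x3 x4 x5 x6 x : T) :
  (x \in mask [:: a; b; c; d; e; f] [:: x1; x2; x3; x4; x5; x6]) =
  [|| a && (x == x1), b && (x == x2), c && (x == x3), d && (x == x4),
      e && (x == x5) | f && (x == x6)].
Proof. by rewrite !mask_cons !mem_cat !mem_nseq !lt0b orbF. Qed.

Lemma AvP n m (s : 'S_n) :
  reflect (forall i j k : 'I_n, i < j -> j < k ->
             pat (oneline s) i j k \notin mask m codes)
          (s \in Av n (pset m)).
Proof.
rewrite inE; apply: (iffP forall_inP) => [av i j k ij jk | H p pP].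
  apply/negP; rewrite -map_code_patterns -map_mask => /mapP[p pP].
  by apply/avoidsP: i j k ij jk; apply: av; rewrite inE.
apply/avoidsP => i j k ij jk e_p.
have /negP := H i j k ij jk; apply; rewrite e_p -map_code_patterns -map_mask.
by apply: map_f; rewrite inE in pP.
Qed.

(** This is transitivity of the order. *)
Lemma pat_codes n (s : 'S_n) (i j k : 'I_n) : pat (oneline s) i j k \in codes.
Proof.
rewrite pat_oneline.
by case: (ltnP (s j) (s i)) => ?; case: (ltnP (s k) (s i)) => ?;
   case: (ltnP (s k) (s j)) => ? //; lia.
Qed.

Definition avoidw (m : bitseq) (w : seq nat) : bool :=
  all (fun k => all (fun j => all (fun i => pat w i j k \notin mask m codes)
    (iota 0 j)) (iota 0 k)) (iota 0 (size w)).

(** [avoidw] is the evaluable counterpart of membership in [Av]. *)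
Lemma avoidwE n m (s : 'S_n) : (s \in Av n (pset m)) = avoidw m (oneline s).
Proof.
apply/AvP/idP => [av | av i j k ij jk].
  rewrite /avoidw size_oneline; apply/allP => k; rewrite mem_iota => /= lt_k.
  apply/allP => j; rewrite mem_iota => /= lt_j.
  apply/allP => i; rewrite mem_iota => /= lt_i.
  have lt_jn := ltn_trans lt_j lt_k; have lt_in := ltn_trans lt_i lt_jn.
  exact: (av (Ordinal lt_in) (Ordinal lt_jn) (Ordinal lt_k)).
have {av}/allP/(_ k) := av; rewrite size_oneline mem_iota ltn_ord => /(_ isT).
by move=> /allP/(_ j); rewrite mem_iota => /(_ jk)/allP/(_ i); rewrite mem_iota => /(_ ij).
Qed.

(** * Evaluating the generating polynomials *)

Lemma oneline_enum n :
  perm_eq [seq oneline s | s <- enum {: 'S_n}] (permutations (iota 1 n)).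
Proof.
apply: uniq_perm; rewrite ?permutations_uniq ?(map_inj_uniq (@oneline_inj n)) ?enum_uniq //.
move=> w; rewrite mem_permutations; apply/mapP/idP => [[s _ ->] | /of_onelineK <-].
  apply: uniq_perm; rewrite ?iota_uniq //.
    by rewrite map_inj_uniq ?enum_uniq // => i j [/val_inj/perm_inj].
  move=> x; rewrite mem_iota; apply/mapP/idP => [[i _ ->] | /andP[x_gt0 lt_x]].
    by rewrite /= ltnS ltn_ord.
  have ltx: x.-1 < n by lia.
  by exists (s^-1 (Ordinal ltx))%g; rewrite ?mem_enum // permKV /= prednK.
by exists (of_oneline n w); rewrite ?mem_enum.
Qed.

Definition profile (stw : seq nat -> nat) n m : seq nat :=
  [seq stw w | w <- permutations (iota 1 n) & avoidw m w].

Lemma genpoly_profile (st : statistic) (stw : seq nat -> nat) n m :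
  (forall s : 'S_n, st n s = stw (oneline s)) ->
  genpoly st n (pset m) = (\sum_(x <- profile stw n m) 'X^x)%R.
Proof.
move=> stE; rewrite /profile big_map.
rewrite -(perm_big _ (perm_filter (avoidw m) (oneline_enum n))) /=.
rewrite filter_map big_map big_filter big_enum_cond.
by apply: eq_big => s /=; rewrite ?avoidwE ?stE.
Qed.

(** The coefficient of 'X^x counts the occurrences of x. *)
Lemma sum_Xn_inj (a b : seq nat) :
  (\sum_(x <- a) 'X^x = \sum_(x <- b) 'X^x :> {poly int})%R -> perm_eq a b.
Proof.
have E c x : ((\sum_(y <- c) 'X^y : {poly int})`_x = (count_mem x c)%:R)%R.
  elim: c => [|y c IH]; first by rewrite big_nil coef0.
  by rewrite big_cons coefD coefXn IH /= natrD eq_sym.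
move=> eq_ab; apply/allP => x _; apply/eqP.
by have /eqP := congr1 (fun p : {poly int} => p`_x)%R eq_ab; rewrite !E eqr_nat => /eqP.
Qed.

(** This makes equality of the generating polynomials decidable by evaluation,
    for a statistic computed on words by [stw]. *)
Lemma genpoly_eqP (st : statistic) (stw : seq nat -> nat) n m1 m2 :
  (forall s : 'S_n, st n s = stw (oneline s)) ->
  reflect (genpoly st n (pset m1) = genpoly st n (pset m2))
          (perm_eq (profile stw n m1) (profile stw n m2)).
Proof.
move=> stE; rewrite !(genpoly_profile _ stE).
by apply: (iffP idP) => [eq_p | /sum_Xn_inj //]; apply: perm_big.
Qed.

(** Both statistics add up a weight over the inversions of the permutation:
    [inv] counts each inversion once, while [maj] counts only those between
    adjacent positions, with their position as weight. *)
Definition inversion_sum (F : nat -> nat -> nat) (w : seq nat) : nat :=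
  sumn [seq sumn [seq F i j | i <- iota 0 j & nth 0 w j < nth 0 w i]
       | j <- iota 0 (size w)].

Lemma inversion_sumE F n (s : 'S_n) :
  inversion_sum F (oneline s)
    = \sum_(ij : 'I_n * 'I_n | (ij.1 < ij.2) && (s ij.2 < s ij.1)) F ij.1 ij.2.
Proof.
have iotaE k : iota 0 k = index_iota 0 k by rewrite /index_iota subn0.
rewrite /inversion_sum size_oneline sumnE big_map iotaE.
rewrite big_mkord -(pair_big_dep xpredT
  (fun i j : 'I_n => (i < j) && (s j < s i)) (fun i j => F i j)).
rewrite (exchange_big_dep xpredT) //=; apply: eq_bigr => j _.
rewrite sumnE big_map big_filter iotaE.
rewrite (big_nat_widen _ _ n) ?(ltnW (ltn_ord j)) // big_mkord.
by apply: eq_bigl => i; rewrite !nth_oneline ltnS andbC.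
Qed.

Definition inv_weight (i j : nat) : nat := 1.

Definition maj_weight (i j : nat) : nat := if j == i.+1 then i.+1 else 0.

Lemma inv_statE n (s : 'S_n) : inv_stat s = inversion_sum inv_weight (oneline s).
Proof. by rewrite inversion_sumE sum1dep_card. Qed.

Lemma maj_statE n (s : 'S_n) : maj_stat s = inversion_sum maj_weight (oneline s).
Proof.
rewrite inversion_sumE /maj_stat /maj_weight -big_mkcondr /=.
apply: eq_bigl => -[i j] /=; case: eqP => [->|]; by rewrite ?ltnSn ?andbT ?andbF.
Qed.

Lemma eq_maj n (s t : 'S_n) :
  (forall i j : 'I_n, j = i.+1 :> nat -> (s j < s i) = (t j < t i)) ->
  maj_stat s = maj_stat t.
Proof. by move=> st; apply: eq_bigl => -[i j] /=; case: eqP => //= /st ->. Qed.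

(** * Inversions: the symmetries of the square *)

Lemma R180_patterns :
  [seq R180 p | p <- patterns] = [:: p123; p213; p132; p312; p231; p321].
Proof.
apply: (inj_map (@oneline_inj 3)); rewrite -map_comp /=.
have R (p : 'S_3) : oneline (R180 p)
    = [seq 4 - x | x <- rev (oneline p)].
  apply: (@eq_from_nth _ 0) => [|i]; rewrite size_oneline.
    by rewrite size_map size_rev size_oneline.
  move=> lt_i.
  rewrite (nth_map 0) ?size_rev ?size_oneline // nth_rev ?size_oneline //.
  have := nth_oneline (R180 p) (Ordinal lt_i); rewrite /= => ->.
  have := nth_oneline p (rev_ord (Ordinal lt_i)); rewrite /= => ->.
  by rewrite R180E /= -subSn.
by rewrite !R; case: oneline_patterns => [[-> -> ->] [-> -> ->]].
Qed.

Lemma r1_patterns :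
  [seq r1 p | p <- patterns] = [:: p123; p132; p213; p312; p231; p321].
Proof.
have I (p q : 'S_3) : (forall i, q (p i) = i) -> r1 p = q.
  by move=> qp; apply/permP => i; rewrite -[in RHS](permKV p i) qp.
have V (p : 'S_3) (i : 'I_3) : p i = (nth 0 (oneline p) i).-1 :> nat.
  by rewrite nth_oneline.
have [[e1 e2 e3] [e4 e5 e6]] := oneline_patterns.
by rewrite /=; congr [:: _; _; _; _; _; _]; apply: I => i; apply: val_inj; rewrite /= !V;
  rewrite ?e1 ?e2 ?e3 ?e4 ?e5 ?e6; case: i => [[|[|[|?]]] ?].
Qed.

Lemma rm1_patterns :
  [seq rm1 p | p <- patterns] = [:: p123; p213; p132; p231; p312; p321].
Proof.
rewrite -[LHS]/[seq r1 p | p <- [seq R180 p | p <- patterns]] R180_patterns.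
have E k := congr1 (nth p123 ^~ k) r1_patterns.
by move: (E 0) (E 1) (E 2) (E 3) (E 4) (E 5) => /= -> -> -> -> -> ->.
Qed.

Lemma imset_pset (f : 'S_3 -> 'S_3) m :
  f @: pset m = [set p in mask m [seq f p | p <- patterns]].
Proof.
apply/setP => p; rewrite inE -map_mask; apply/imsetP/mapP.
  by case=> q; rewrite inE; exists q.
by case=> q qP ->; exists q; rewrite // inE.
Qed.

(** Positions 1 and 2 of a mask stand for 132 and 213, positions 3 and 4 for 231
    and 312. *)
Definition swapm (swap12 swap34 : bool) (m : bitseq) :=
  let x i := nth false m i in
  [:: x 0; x (if swap12 then 2 else 1); x (if swap12 then 1 else 2);
      x (if swap34 then 4 else 3); x (if swap34 then 3 else 4); x 5].

Lemma inv3_separation_check :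
  all (fun m1 => all (fun m2 =>
     perm_eq (profile (inversion_sum inv_weight) 3 m1)
             (profile (inversion_sum inv_weight) 3 m2)
     ==> (m2 \in [:: swapm false false m1; swapm false true m1;
                   swapm true false m1; swapm true true m1])) masks) masks.
Proof. by vm_compute. Qed.

Lemma trivially_equiv_of_inv3 (P Q : {set 'S_3}) :
  genpoly inv_stat 3 P = genpoly inv_stat 3 Q -> trivially_equiv P Q.
Proof.
have [m1 m1P ->] := pset_surj P; have [m2 m2P ->] := pset_surj Q.
move/(genpoly_eqP _ _ (@inv_statE 3)) => same.
have /allP/(_ _ m1P)/allP/(_ _ m2P) := inv3_separation_check; rewrite same.
have m1_sz := size_masks m1P.
move: m1 m1_sz {m1P same} => [|a [|b [|c [|d [|e [|f [|? ?]]]]]]] // _.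
rewrite /trivially_equiv !imset_pset R180_patterns r1_patterns rm1_patterns.
have -> : [seq R0 p | p <- patterns] = patterns by [].
rewrite ![swapm _ _ _]/= !inE => /or4P[]/eqP-> {m2 m2P};
  [apply: Or41 | apply: Or44 | apply: Or43 | apply: Or42];
  apply/setP => p; rewrite !inE !mem_mask6 //; congr (_ || _); do ?bool_congr.
Qed.

(** * Major index: separating the classes *)

Definition listed_masks : seq (bitseq * bitseq) :=
  [:: ([:: true; true; true; true; false; false], [:: true; true; false; true; true; false]);
      ([:: true; true; true; false; true; false], [:: true; false; true; true; true; false]);
      ([:: true; true; false; false; true; true], [:: true; false; true; true; false; true]);
      ([:: false; true; true; true; false; true], [:: false; true; false; true; true; true]);
      ([:: false; true; true; false; true; true], [:: false; false; true; true; true; true]);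
      ([:: true; true; true; true; false; true], [:: true; true; false; true; true; true]);
      ([:: true; true; true; false; true; true], [:: true; false; true; true; true; true])].

Lemma listed_classesE :
  listed_classes = [seq [set pset ab.1; pset ab.2] | ab <- listed_masks].
Proof.
rewrite /listed_classes /=; do !congr cons; congr [set _; _];
  by apply/setP => p; rewrite !inE !orbA.
Qed.

Definition partners (m : bitseq) : seq bitseq :=
  [seq ab.2 | ab <- listed_masks & ab.1 == m] ++ [seq ab.1 | ab <- listed_masks & ab.2 == m].

Definition large_mask (m : bitseq) := nth false m 0 && nth false m 5 || (4 <= count id m).

Lemma large_mask_pset m : m \in masks ->
  contains_mono_or_large (pset m) -> large_mask m.
Proof.
move/size_masks => m_sz; rewrite /contains_mono_or_large card_pset // /large_mask.
case/orP=> [/subsetP sub | ->]; last by rewrite orbT.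
have mem_p k : k < 6 -> (nth p123 patterns k \in pset m) = nth false m k.
  move=> lt_k6; rewrite inE in_mask ?uniq_patterns // mem_nth // index_uniq //.
  exact: uniq_patterns.
rewrite -(mem_p 0 isT) -(mem_p 5 isT) !sub //.
  by rewrite !inE eqxx orbT.
by rewrite !inE eqxx.
Qed.

Definition same_maj n m1 m2 := perm_eq (profile (inversion_sum maj_weight) n m1)
             (profile (inversion_sum maj_weight) n m2).

Lemma maj34_separation_check :
  all (fun m1 => all (fun m2 =>
     (same_maj 3 m1 m2 && same_maj 4 m1 m2)
     ==> (m2 \in m1 :: partners m1)) masks) [seq m <- masks | large_mask m].
Proof. by vm_compute. Qed.

Lemma maj_partners m1 m2 : m1 \in masks -> m2 \in masks -> large_mask m1 ->
  Wilf_equiv maj_stat (pset m1) (pset m2) -> m2 \in m1 :: partners m1.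
Proof.
move=> m1P m2P m1_large eq12.
have m1_in : m1 \in [seq m <- masks | large_mask m] by rewrite mem_filter m1_large.
have /allP/(_ _ m1_in)/allP/(_ _ m2P)/implyP := maj34_separation_check; apply.
by apply/andP; split; apply/(genpoly_eqP _ _ (@maj_statE _)).
Qed.

(** * Avoiding both monotone patterns *)

(** If neither 123 nor 321 occurs, then for i < j < k the comparisons of the
    entries i, j and of the entries j, k are opposite.  Positions 0, ..., 4 then
    give a contradiction: the pairs 12 and 13 compare alike, both being opposite
    to 01, while 34 must be opposite both to 13 and to 23, itself opposite
    to 12. *)
Lemma Av_mono_empty n (a b c d : bool) :
  4 < n -> Av n (pset [:: true; a; b; c; d; true]) = set0.
Proof.
move=> lt4n; apply/setP => s; rewrite [RHS]inE; apply/negP => /AvP av.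
have alt (i j k : 'I_n) : i < j -> j < k -> (s k < s j) = ~~ (s j < s i).
  move=> ij jk; have := av i j k ij jk.
  have := pat_codes s i j k; rewrite mem_mask6 pat_oneline.
  by case: (s j < s i) (s k < s i) (s k < s j) => [] [] [] //=; rewrite ?orbT.
have l i : i < 5 -> i < n by move/leq_trans; apply.
pose x i (lt_i5 : i < 5) := Ordinal (l i lt_i5).
have alt012 := alt (x 0 isT) (x 1 isT) (x 2 isT) isT isT.
have alt013 := alt (x 0 isT) (x 1 isT) (x 3 isT) isT isT.
have alt123 := alt (x 1 isT) (x 2 isT) (x 3 isT) isT isT.
have alt134 := alt (x 1 isT) (x 3 isT) (x 4 isT) isT isT.
have := alt (x 2 isT) (x 3 isT) (x 4 isT) isT isT.
by rewrite alt134 alt123 alt012 alt013; case: (_ < _).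
Qed.

(** * Pairs of avoiders at every length *)

(** The value of a permutation at a position is the number of smaller entries,
    which is read off from the inversions. *)
Lemma eq_perm_inversions n (s t : 'S_n) :
  (forall i j : 'I_n, i < j -> (s j < s i) = (t j < t i)) -> s = t.
Proof.
move=> same; have lt_st i j : (s j < s i) = (t j < t i).
  case: (ltngtP i j) => [/same // | lt_ji | /val_inj ->]; last by rewrite !ltnn.
  have ne : j != i by rewrite -val_eqE neq_ltn lt_ji.
  by rewrite !(perm_ltn_asym _ ne) same.
have rank (u : 'S_n) i : #|[set j | u j < u i]| = u i.
  have -> : [set j | u j < u i] = u @^-1: [set x : 'I_n | x < u i].
    by apply/setP => j; rewrite !inE.
  rewrite card_preimset; last exact: perm_inj.
  by rewrite -sum1dep_card -(big_ord_widen n (fun=> 1)) ?sum1_card ?card_ord // ltnW.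
by apply/permP => i; apply: val_inj; rewrite /= -[LHS]rank -[RHS]rank;
  apply: eq_card => j; rewrite !inE lt_st.
Qed.

(** The monotone permutation, decreasing if [o] holds.  Applying it to the
    values of a permutation reverses all comparisons exactly when [o] holds, so
    that the increasing and the decreasing cases can be treated together. *)
Definition sgn n (o : bool) : 'S_n := if o then rev_perm n else 1%g.

Lemma sgn_inversion n (w : 'S_n) o (i j : 'I_n) : i < j ->
  ((w * sgn n o)%g j < (w * sgn n o)%g i) = o (+) (w j < w i).
Proof.
move=> ij; case: o; rewrite !permM ?perm1 // !permE [RHS]/=.
have ne: i != j by rewrite -val_eqE neq_ltn ij.
by rewrite -(perm_ltn_asym w ne) /= ltn_sub2lE.
Qed.

(** The identity with its last entry moved down, to the bottom if [y] holds and
    by one step otherwise. *)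
Definition last_moved m (y : bool) : 'S_m.+3 :=
  lift_perm ord_max (if y then ord0 else inord m.+1) 1.

(** The identity with its first entry moved up, to the top if [y] holds and by
    one step otherwise. *)
Definition first_moved m (y : bool) : 'S_m.+3 :=
  lift_perm ord0 (if y then ord_max else inord 1) 1.

Lemma last_moved_inversion m y (i j : 'I_m.+3) : i < j ->
  (last_moved m y j < last_moved m y i) =
    (j == m.+2 :> nat) && (y || (i == m.+1 :> nat)).
Proof.
case: (unliftP ord_max i) => [i' ->|->]; last by rewrite ltnNge leq_ord.
rewrite /last_moved lift_perm_lift perm1 [lift ord_max i' : nat]lift_max.
case: (unliftP ord_max j) => [j' ->|-> _].
  rewrite lift_perm_lift perm1 [lift ord_max j' : nat]lift_max => lt_ij.
  by rewrite ltnNge leq_bump2 (ltnW lt_ij) (ltn_eqF (ltn_ord j')).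
rewrite lift_perm_id eqxx; have := ltn_ord i'.
by case: y => //; rewrite /= /bump inordK //; case: ltnP => /=; lia.
Qed.

Lemma first_moved_inversion m y (i j : 'I_m.+3) : i < j ->
  (first_moved m y j < first_moved m y i) =
    (i == 0 :> nat) && (y || (j == 1 :> nat)).
Proof.
case: (unliftP ord0 j) => [j' ->|->] //; rewrite /first_moved lift_perm_lift perm1 lift0.
case: (unliftP ord0 i) => [i' ->|-> _].
  by rewrite lift_perm_lift perm1 lift0 ltnS => lt_ij; rewrite ltnNge leq_bump2 (ltnW lt_ij).
rewrite lift_perm_id eqxx; have := ltn_ord j'.
by case: y; rewrite /= /bump ?inordK //; case: ltnP => /=; lia.
Qed.

Definition allowed (m : bitseq) : seq (bool * bool * bool) :=
  [seq c <- codes | c \notin mask m codes].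

(** The scheme common to [Av_last_moved] and [Av_first_moved]: since inversions
    determine a permutation, it suffices that the inversions of an avoider are
    those of [sgn n o], or those of [w * sgn n o], and that both are admissible.
    The boolean [c] distinguishes the two. *)
Lemma Av_pair n m o (w : 'S_n) :
  (forall c (i j k : 'I_n), i < j -> j < k ->
     (o (+) (c && (w j < w i)), o (+) (c && (w k < w i)), o (+) (c && (w k < w j)))
       \in allowed m) ->
  (forall s : 'S_n,
     (forall i j k : 'I_n, i < j -> j < k -> pat (oneline s) i j k \in allowed m) ->
     exists c, forall i j : 'I_n, i < j -> (s j < s i) = o (+) (c && (w j < w i))) ->
  Av n (pset m) = [set sgn n o; (w * sgn n o)%g].
Proof.
pose v c := if c then w else 1%g.
have v_inv c (i j : 'I_n) : i < j -> (v c j < v c i) = c && (w j < w i).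
  by case: c => // ij; rewrite !perm1 ltnNge ltnW.
(* [v c * sgn n o] runs over both permutations, so inversions can be computed
   uniformly in c. *)
have -> : [set sgn n o; (w * sgn n o)%g] = [set (v c * sgn n o)%g | c : bool].
  apply/setP => s; apply/set2P/imsetP => [[]-> | [[] _ ->]].
  - by exists false; rewrite ?mul1g.
  - by exists true.
  - by right.
  - by left; rewrite mul1g.
move=> w_ok w_only; apply/setP => s; apply/AvP/imsetP => [av | [c _ ->] i j k ij jk].
  have [|c s_inv] := w_only s.
    by move=> i j k ij jk; rewrite mem_filter av ?pat_codes.
  exists c => //; apply: eq_perm_inversions => i j ij.
  by rewrite sgn_inversion // v_inv // s_inv.
have ik := ltn_trans ij jk.
have := w_ok c i j k ij jk; rewrite mem_filter => /andP[+ _].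
by rewrite pat_oneline !sgn_inversion // !v_inv.
Qed.

(** The first two entries of a triple compare as [o], so only comparisons with
    the last position are free.  The comparison of the last two entries forces
    the others: if it agrees with [o], so do they all, and otherwise each of
    them is [o (+) y]. *)
Lemma Av_last_moved n m o y :
  allowed m =i [:: (o, o, o); (o, o (+) y, ~~ o)] ->
  Av n.+3 (pset m) = [set sgn n.+3 o; (last_moved n y * sgn n.+3 o)%g].
Proof.
move=> allow; apply: Av_pair => [c i j k ij jk | s av].
  have ik := ltn_trans ij jk; have lt_k := ltn_ord k.
  rewrite allow !last_moved_inversion // !inE.
  have -> : (j == n.+2 :> nat) = false by apply/eqP; lia.
  have -> : (i == n.+1 :> nat) = false by apply/eqP; lia.
  by clear; case: c o y (k == n.+2 :> nat) (j == n.+1 :> nat) => [] [] [] [] [].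
have lt_n1 : n.+1 < n.+3 by []. pose b := Ordinal lt_n1.
(* c tells whether the last two entries compare against the orientation. *)
exists ((s ord_max < s b) (+) o) => i j ij; rewrite last_moved_inversion //.
have [j_max | j_max] := eqVneq (j : nat) n.+2; last first.
  have j_lt : j < (@ord_max n.+2) by rewrite /=; have := ltn_ord j; lia.
  have := av i j ord_max ij j_lt.
  by rewrite allow pat_oneline andbF addbF !inE => /orP[]/eqP[].
have {}j_max : j = ord_max by apply: val_inj.
rewrite j_max in ij *.
have [i_b | i_b] := eqVneq (i : nat) n.+1.
  have -> : i = b by apply: val_inj.
  by rewrite orbT !andbT [RHS]addbC -addbA addbb addbF.
have ib : i < b by rewrite ltn_neqAle i_b.
have := av i b ord_max ib (ltnSn _); rewrite allow pat_oneline orbF andTb !inE.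
by clear; case: (s ord_max < s i) (s ord_max < s b) (s b < s i) o y => [] [] [] [] [].
Qed.

(** The mirror image of [Av_last_moved]: the comparison of the first two entries
    forces all comparisons with the first entry. *)
Lemma Av_first_moved n m o y :
  allowed m =i [:: (o, o, o); (~~ o, o (+) y, o)] ->
  Av n.+3 (pset m) = [set sgn n.+3 o; (first_moved n y * sgn n.+3 o)%g].
Proof.
move=> allow; apply: Av_pair => [c i j k ij jk | s av].
  have ik := ltn_trans ij jk.
  rewrite allow !first_moved_inversion // !inE.
  have -> : (j == 0 :> nat) = false by apply/eqP; lia.
  have -> : (k == 1 :> nat) = false by apply/eqP; lia.
  by clear; case: c o y (i == 0 :> nat) (j == 1 :> nat) => [] [] [] [] [].
have lt_1n : 1 < n.+3 by []. pose b := Ordinal lt_1n.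
exists ((s b < s ord0) (+) o) => i j ij; rewrite first_moved_inversion //.
have [i_0 | i_0] := eqVneq (i : nat) 0; last first.
  have i_gt0 : (@ord0 n.+2) < i by rewrite lt0n.
  have := av ord0 i j i_gt0 ij.
  by rewrite allow pat_oneline andbF addbF !inE => /orP[]/eqP[].
have {}i_0 : i = ord0 by apply: val_inj.
rewrite i_0 in ij *.
have [j_b | j_b] := eqVneq (j : nat) 1.
  have -> : j = b by apply: val_inj.
  by rewrite orbT !andbT [RHS]addbC -addbA addbb addbF.
have bj : b < j by rewrite ltn_neqAle eq_sym j_b.
have := av ord0 b j isT bj; rewrite allow pat_oneline orbF andTb !inE.
by clear; case: (s j < s ord0) (s b < s ord0) (s j < s b) o y => [] [] [] [] [].
Qed.

Lemma genpoly_pair n m o (w : 'S_n) : w != 1%g ->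
  Av n (pset m) = [set sgn n o; (w * sgn n o)%g] ->
  (genpoly maj_stat n (pset m)
    = 'X^(maj_stat (sgn n o)) + 'X^(maj_stat (w * sgn n o)%g))%R.
Proof.
move=> w_neq1 AvE; rewrite /genpoly AvE big_setU1 ?big_set1 //= inE.
by rewrite -{1}[sgn n o]mul1g (inj_eq (mulIg _)) eq_sym.
Qed.

(** Whatever [y1] and [y2] are, [last_moved] has its last adjacent pair as its
    only descent; applying [sgn n o] to the values keeps the descents or
    complements them, in the same way for both sets. *)
Lemma genpoly_last_moved n m1 m2 o y1 y2 :
  allowed m1 =i [:: (o, o, o); (o, o (+) y1, ~~ o)] ->
  allowed m2 =i [:: (o, o, o); (o, o (+) y2, ~~ o)] ->
  genpoly maj_stat n.+3 (pset m1) = genpoly maj_stat n.+3 (pset m2).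
Proof.
have ne1 y : last_moved n y != 1%g.
  have lt_n1 : n.+1 < n.+3 by []. pose b := Ordinal lt_n1.
  have := @last_moved_inversion n y b ord_max (ltnSn _); apply: contra_eqN => /eqP->.
  by rewrite !perm1 !eqxx orbT ltnNge leqnSn.
move=> /Av_last_moved/genpoly_pair-> // /Av_last_moved/genpoly_pair-> //.
congr ('X^_ + 'X^_)%R; apply: eq_maj => i j j_i.
have ij : i < j by rewrite j_i.
rewrite !sgn_inversion // !last_moved_inversion // j_i eqSS.
by have [_ | //] := eqVneq (i : nat) n.+1; rewrite !orbT.
Qed.

(** Here the only descent of [first_moved] is its first adjacent pair. *)
Lemma genpoly_first_moved n m1 m2 o y1 y2 :
  allowed m1 =i [:: (o, o, o); (~~ o, o (+) y1, o)] ->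
  allowed m2 =i [:: (o, o, o); (~~ o, o (+) y2, o)] ->
  genpoly maj_stat n.+3 (pset m1) = genpoly maj_stat n.+3 (pset m2).
Proof.
have ne1 y : first_moved n y != 1%g.
  have lt_1n : 1 < n.+3 by []. pose b := Ordinal lt_1n.
  have := @first_moved_inversion n y ord0 b isT; apply: contra_eqN => /eqP->.
  by rewrite !perm1 !eqxx orbT.
move=> /Av_first_moved/genpoly_pair-> // /Av_first_moved/genpoly_pair-> //.
congr ('X^_ + 'X^_)%R; apply: eq_maj => i j j_i.
have ij : i < j by rewrite j_i.
rewrite !sgn_inversion // !first_moved_inversion // j_i eqSS.
by have [_ | //] := eqVneq (i : nat) 0; rewrite !orbT.
Qed.

(** * The equivalence classes *)

Lemma maj_listed_check :
  all (fun ab => all (fun n => same_maj n ab.1 ab.2) (iota 0 5)) listed_masks.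
Proof. by vm_compute. Qed.

Lemma maj_equiv_listed ab : ab \in listed_masks ->
  Wilf_equiv maj_stat (pset ab.1) (pset ab.2).
Proof.
move=> ab_in n; have [lt_n5 | le5n] := ltnP n 5.
  apply/(genpoly_eqP _ _ (@maj_statE n)).
  have /allP/(_ _ ab_in)/allP := maj_listed_check; apply.
  by rewrite mem_iota.
case: n le5n => [|[|[|n]]] // le5n.
have eq_seq (s t : seq (bool * bool * bool)) :
    all [in t] s && all [in s] t -> s =i t.
  by case/andP=> /allP st /allP ts x; apply/idP/idP => [/st|/ts].
move: ab_in; rewrite !inE.
do ![case/orP] => /eqP-> /=.
(* For the four pairs with two avoiders, o and y1, y2 are read off from the
   two patterns that the masks leave out: 321 with 312 or 213, 321 with 231 or
   132, 123 with 312 or 213, 123 with 231 or 132. *)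
- by apply: (@genpoly_last_moved _ _ _ true false true); apply: eq_seq.
- by apply: (@genpoly_first_moved _ _ _ true false true); apply: eq_seq.
- by rewrite /genpoly !(Av_mono_empty _ _ _ _ le5n).
- by apply: (@genpoly_first_moved _ _ _ false true false); apply: eq_seq.
- by apply: (@genpoly_last_moved _ _ _ false true false); apply: eq_seq.
- by rewrite /genpoly !(Av_mono_empty _ _ _ _ le5n).
- by rewrite /genpoly !(Av_mono_empty _ _ _ _ le5n).
Qed.

Lemma maj_class_listed ab : ab \in listed_masks ->
  forall Q, Q \in [set pset ab.1; pset ab.2] <-> Wilf_equiv maj_stat (pset ab.1) Q.
Proof.
move=> ab_in Q; split=> [/set2P[]-> // | ]; first exact: maj_equiv_listed.
have /allP/(_ _ ab_in)/and3P[ab1 large /eqP ab2] : all (fun ab =>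
    [&& ab.1 \in masks, large_mask ab.1 & partners ab.1 == [:: ab.2]]) listed_masks.
  by [].
have [m mP ->] := pset_surj Q.
by move/(maj_partners ab1 mP large); rewrite ab2 !inE => /orP[]/eqP->; rewrite eqxx ?orbT.
Qed.

Theorem theorem8p2 :
  (forall P Q : {set 'S_3},
      contains_mono_or_large P -> contains_mono_or_large Q ->
      Wilf_equiv inv_stat P Q -> trivially_equiv P Q)
  /\
  (forall C : {set {set 'S_3}}, C \in listed_classes -> Wilf_class maj_stat C)
  /\
  (forall C : {set {set 'S_3}},
      Wilf_class maj_stat C ->
      (exists2 P, P \in C & contains_mono_or_large P) ->
      C \notin listed_classes -> #|C| = 1).
Proof.
split; first by move=> P Q _ _ PQ; apply: trivially_equiv_of_inv3.
split=> [C | C [P0 C_class] [P PC P_large] C_unlisted].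
  by rewrite listed_classesE => /mapP[ab ab_in ->]; exists (pset ab.1);
    apply: maj_class_listed.
have {P0 C_class PC} C_class Q : Q \in C <-> Wilf_equiv maj_stat P Q.
  have /C_class P0P := PC.
  by split=> [/C_class P0Q n | PQ]; [rewrite -P0P | apply/C_class => n; rewrite P0P].
have [m mP P_m] := pset_surj P; rewrite {}P_m in P_large C_class.
(* A listed set has its listed pair as class, and C is not listed. *)
have m_unlisted ab : ab \in listed_masks -> (m != ab.1) && (m != ab.2).
  move=> ab_in; rewrite -negb_or; apply: contra C_unlisted => m_ab.
  have ab_m : Wilf_equiv maj_stat (pset ab.1) (pset m).
    apply/(maj_class_listed ab_in); rewrite !inE.
    by case/orP: m_ab => /eqP->; rewrite eqxx ?orbT.
  rewrite listed_classesE; apply/mapP; exists ab => //; apply/setP => Q.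
  apply/idP/idP => [/C_class mQ | /(maj_class_listed ab_in) abQ].
    by apply/(maj_class_listed ab_in) => n; rewrite ab_m.
  by apply/C_class => n; rewrite -ab_m.
have no_partner : partners m = [::].
  have none p : {in listed_masks, forall ab, ~~ p ab} -> [seq ab <- listed_masks | p ab] = [::].
    by move=> np; apply/eqP; rewrite -[_ == _]negbK -has_filter; apply/hasPn.
  by rewrite /partners !none // => ab /m_unlisted/andP[]; rewrite ![m == _]eq_sym.
suff -> : C = [set pset m] by rewrite cards1.
apply/setP => Q; apply/idP/set1P => [/C_class | -> ]; last by apply/C_class.
have [m' m'P ->] := pset_surj Q.
move/(maj_partners mP m'P (large_mask_pset mP P_large)).
by rewrite no_partner mem_seq1 => /eqP->.
Qed.
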